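(* Let $P$ be the set of all integer partitions and $D$ the set of partitions into distinct parts (each including the empty partition of $0$). Define $P_1:=\{\pi\in D:\#(\pi)\not\equiv 0 \pmod 3\}$, $P_2:=\{\pi\in P: \text{no part of }\pi\text{ is divisible by }3\}$, and $P_3:=\{\pi\in P:\#(\pi)\not\equiv 0\pmod 3\}$. For a partition $\pi$ let $\sigma(\pi)=1$ if $\#(\pi)\equiv 2\pmod 3$ and $\sigma(\pi)=0$ otherwise, and let $\mu(\pi):=\#(\pi)+\sigma(\pi)+1$. Then, as formal power series in $q$, \[ \sum_{\pi\in P_1}(-1)^{\mu(\pi)}q^{|\pi|}=\sum_{(\pi_1,\pi_2)\in P_2\times P_3}(-1)^{\sigma(\pi_2)}q^{|\pi_1|+|\pi_2|}. \]
   Context: A partition of a non-negative integer $n$ is a non-increasing finite sequence of positive integers summing to $n$; the empty sequence is the unique partition of $0$. For a partition $\pi$, $|\pi|$ denotes the sum of its parts and $\#(\pi)$ its number of parts. *)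

(* Defs.v *)
From mathcomp Require Import all_boot all_order all_algebra.
From mathcomp Require Import all_classical.

Set Implicit Arguments.
Unset Strict Implicit.
Unset Printing Implicit Defensive.

Import Order.TTheory GRing.Theory Num.Theory.
Local Open Scope classical_set_scope.
Local Open Scope ring_scope.

(* |pi| is sumn and #(pi) is size. *)
Definition partitions : set (seq nat) :=
  [set p | sorted geq p /\ all (fun k => 0 < k)%N p].

Definition distinct_partitions : set (seq nat) :=
  [set p | partitions p /\ uniq p].

Definition P1 : set (seq nat) :=
  [set p | distinct_partitions p /\ size p <> 0 %[mod 3]].

Definition P2 : set (seq nat) :=
  [set p | partitions p /\ forall k, k \in p -> ~~ (3 %| k)%N].

Definition P3 : set (seq nat) :=
  [set p | partitions p /\ size p <> 0 %[mod 3]].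

Definition sigma (p : seq nat) : nat := (size p == 2 %[mod 3]).

Definition mu (p : seq nat) : nat := (size p + sigma p + 1)%N.

(* A formal power series is its sequence of coefficients.  gen_series A w c is
   the series sum_(x in A) c x q^(w x): its coefficient of q^n sums c over the
   elements of A of weight n.  The sum over a set is 0 by convention when its
   support is infinite; finite_partitions_of and finite_partition_pairs_of
   below show that this never occurs for partitions and pairs of partitions. *)
Definition gen_series (T : choiceType) (A : set T) (w : T -> nat)
    (c : T -> int) : nat -> int :=
  fun n => \sum_(x \in A `&` [set x | w x = n]) c x.

Lemma finite_partitions_of (n : nat) :
  finite_set (partitions `&` [set p | sumn p = n]).
Proof.
pose F (k : 'I_n.+1) : set (seq nat) :=
  (fun t : k.-tuple 'I_n.+1 => map val t) @` setT.
apply: (@sub_finite_set _ _ (\bigcup_(k in [set: 'I_n.+1]) F k)); last first.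
  by apply: bigcup_finite => // k _; apply: finite_image.
move=> p [[_ p_gt0] /= sp].
have le_size : (size p < n.+1)%N.
  rewrite ltnS -sp; elim: p p_gt0 {sp} => //= a p IH /andP[a0 /IH].
  by rewrite -add1n => /(leq_add a0).
have le_part k : k \in p -> (k < n.+1)%N.
  rewrite ltnS -sp => {sp p_gt0 le_size}; elim: p => //= a p IH.
  rewrite inE => /orP[/eqP->|/IH h]; first exact: leq_addr.
  exact: leq_trans h (leq_addl _ _).
exists (Ordinal le_size) => //=.
exists (map_tuple inord (in_tuple p)) => //=.
rewrite -map_comp -[RHS]map_id; apply/eq_in_map => k /le_part hk /=.
exact: inordK.
Qed.

Lemma finite_partition_pairs_of (n : nat) :
  finite_set ((partitions `*` partitions) `&`
              [set pp | (sumn pp.1 + sumn pp.2)%N = n]).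
Proof.
pose G (k : 'I_n.+1) := partitions `&` [set p | sumn p = k].
pose B := \bigcup_(k in [set: 'I_n.+1]) G k.
have fB : finite_set B.
  by apply: bigcup_finite => // k _; apply: finite_partitions_of.
apply: (@sub_finite_set _ _ (B `*` B)); last exact: finite_setX.
move=> [p q] [[/= Pp Pq] spq].
have hp : (sumn p < n.+1)%N by rewrite ltnS -spq leq_addr.
have hq : (sumn q < n.+1)%N by rewrite ltnS -spq leq_addl.
by split => /=; [exists (Ordinal hp)|exists (Ordinal hq)].
Qed.

(* Main.v *)
(** Let w be a primitive cube root of unity. Weighting each part by w, the
    partitions have generating function 1/(wq;q) and the distinct partitions,
    with sign (-1)^#, have (wq;q). Since w^k - w^(2k) is w - w^2 times the
    nonprincipal character modulo 3 at k, the right-hand side of the theorem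
    times w - w^2 is (q^3;q^3)/(q;q) * (1/(wq;q) - 1/(w^2q;q)). The identity
    (q;q)(wq;q)(w^2q;q) = (q^3;q^3) turns this into (w^2q;q) - (wq;q), which is
    the left-hand side times w - w^2. To compare the coefficients of q^n, only
    parts at most n and multiplicities at most n matter, so all products are
    finite polynomial products modulo q^(n+1). *)

Require Import Defs.
From mathcomp Require Import all_boot all_order all_algebra.
From mathcomp Require Import all_field ring.
From mathcomp Require Import all_classical.
Import Order.TTheory GRing.Theory Num.Theory.
Local Open Scope classical_set_scope.
Local Open Scope ring_scope.

(** * Partitions encoded by multiplicity functions *)

(* [f i] is the multiplicity of the part [i.+1]. *)
Definition partition_of_mult (n k : nat) (f : {ffun 'I_n -> 'I_k.+1}) : seq nat :=
  sort geq (flatten [seq nseq (f i) i.+1 | i <- enum 'I_n]).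

(** The case [k = 1] lists partitions into distinct parts; the case [k = n] omits no partition of
    weight at most [n]. *)
Definition bounded_partitions (n k : nat) : seq (seq nat) :=
  [seq partition_of_mult n k f | f <- enum {ffun 'I_n -> 'I_k.+1}].

Lemma big_partition_of_mult (R : Type) (idx : R) (op : Monoid.com_law idx)
    (n k : nat) (F : nat -> R) (f : {ffun 'I_n -> 'I_k.+1}) :
  \big[op/idx]_(a <- partition_of_mult n k f) F a =
  \big[op/idx]_(i < n) iter (f i) (op (F i.+1)) idx.
Proof.
rewrite (perm_big _ (permEl (perm_sort _ _))) big_flatten big_map big_enum.
by apply: eq_bigr => i _; rewrite big_nseq.
Qed.

Lemma sumn_partition_of_mult (n k : nat) (f : {ffun 'I_n -> 'I_k.+1}) :
  sumn (partition_of_mult n k f) = (\sum_(i < n) f i * i.+1)%N.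
Proof.
rewrite sumnE big_partition_of_mult; apply: eq_bigr => i _.
by rewrite iter_addn_0 mulnC.
Qed.

Lemma count_partition_of_mult (n k : nat) (f : {ffun 'I_n -> 'I_k.+1}) (a : nat) :
  count_mem a (partition_of_mult n k f) = (\sum_(i < n) (i.+1 == a) * f i)%N.
Proof.
rewrite -sumn_count sumnE big_map big_partition_of_mult.
by apply: eq_bigr => i _; rewrite iter_addn_0.
Qed.

Lemma count_partition_of_multS (n k : nat) (f : {ffun 'I_n -> 'I_k.+1}) (i : 'I_n) :
  count_mem i.+1 (partition_of_mult n k f) = f i.
Proof.
rewrite count_partition_of_mult (bigD1 i) //= eqxx mul1n big1 ?addn0 // => j.
by rewrite eqSS -(inj_eq val_inj) => /negPf ->.
Qed.

Lemma partition_of_mult_inj (n k : nat) : injective (partition_of_mult n k).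
Proof.
move=> f g efg; apply/ffunP => i; apply/val_inj.
by rewrite /= -!count_partition_of_multS efg.
Qed.

Lemma uniq_bounded_partitions (n k : nat) : uniq (bounded_partitions n k).
Proof. by rewrite map_inj_uniq ?enum_uniq //; apply: partition_of_mult_inj. Qed.

Lemma partition_of_multP (n k : nat) (f : {ffun 'I_n -> 'I_k.+1}) :
  partitions (partition_of_mult n k f).
Proof.
split; first by apply: sort_sorted => x y; rewrite /geq orbC; apply: leq_total.
rewrite all_sort; apply/allP => x /flattenP[s /mapP[i _ ->]].
by rewrite mem_nseq => /andP[_ /eqP ->].
Qed.

Lemma mem_bounded_partitions (n k : nat) (p : seq nat) :
  partitions p -> (sumn p <= n)%N -> (forall a, (count_mem a p <= k)%N) ->
  p \in bounded_partitions n k.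
Proof.
move=> [sp p0] sumpn cp.
pose f : {ffun 'I_n -> 'I_k.+1} := [ffun i : 'I_n => inord (count_mem i.+1 p)].
apply/mapP; exists f; first by rewrite mem_enum.
(* Sorted sequences that are permutations of each other coincide, so only multiplicities remain to
   be compared. *)
apply: (@sorted_eq _ geq) => //.
- by move=> y x z /= xy yz; apply: leq_trans yz xy.
- by move=> x y; rewrite andbC => /anti_leq.
- by case: (partition_of_multP n k f).
have le_part a : a \in p -> (a <= n)%N.
  move=> ap; apply: leq_trans sumpn; rewrite sumnE.
  by rewrite (big_rem a ap) /= leq_addr.
apply/allP => a _; apply/eqP.
have [/andP[a0 an]|] := boolP (0 < a <= n)%N.
  case: a a0 an => // a _ an.
  by rewrite (count_partition_of_multS n k f (Ordinal an)) ffunE inordK // ltnS.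
(* Here [a] is 0 or exceeds [n], so both multiplicities vanish. *)
move=> an; rewrite count_partition_of_mult big1 => [|i _].
  apply/count_memPn/negP => ap; case/negP: an.
  by rewrite le_part // (allP p0).
by case: eqP => // ia; case/negP: an; rewrite -ia /= ltn_ord.
Qed.

(** Turns a coefficient of [gen_series] into a sum over an explicit list; the inclusion in [r] keeps
    the support finite, so the default value 0 does not interfere. *)
Lemma sum_set_seq (T : choiceType) (V : zmodType) (A : set T) (r : seq T)
    (F : T -> V) :
  uniq r -> A `<=` [set` r] ->
  \sum_(x \in A) F x = \sum_(x <- r | x \in A) F x.
Proof.
move=> ur Ar; rewrite (@fsbigE _ _ _ _ A [seq x <- r | x \in A]).
- rewrite big_filter_cond; apply: eq_bigl => x; exact: andbb.
- exact: filter_uniq.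
- by move=> x; rewrite /= mem_filter => /andP[/set_mem].
- by move=> x Ax; rewrite mem_filter mem_set // (Ar x Ax).
Qed.

(** * Polynomials modulo a power of the variable *)

(* A series is truncated to a polynomial: only coefficients below N are compared. *)
Definition eq_trunc (R : comNzRingType) (N : nat) (p q : {poly R}) : Prop :=
  forall i, (i < N)%N -> p`_i = q`_i.

Section Truncation.
Variables (R : comNzRingType) (N : nat).
Implicit Types p q : {poly R}.

Lemma eq_trunc_sym p q : eq_trunc R N p q -> eq_trunc R N q p.
Proof. by move=> pq i iN; rewrite pq. Qed.

Lemma eq_trunc_trans q p r :
  eq_trunc R N p q -> eq_trunc R N q r -> eq_trunc R N p r.
Proof. by move=> pq qr i iN; rewrite pq // qr. Qed.

Lemma eq_truncM p p' q q' :
  eq_trunc R N p p' -> eq_trunc R N q q' -> eq_trunc R N (p * q) (p' * q').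
Proof.
move=> pp qq i iN; rewrite !coefM; apply: eq_bigr => j _.
by rewrite pp ?qq //; apply: leq_ltn_trans iN; rewrite ?leq_subr // -ltnS.
Qed.

Lemma eq_truncB p p' q q' :
  eq_trunc R N p p' -> eq_trunc R N q q' -> eq_trunc R N (p - q) (p' - q').
Proof. by move=> pp qq i iN; rewrite !coefB pp // qq. Qed.

Lemma eq_trunc_prod1 (I : Type) (r : seq I) (P : pred I) (F : I -> {poly R}) :
  (forall i, P i -> eq_trunc R N (F i) 1) ->
  eq_trunc R N (\prod_(i <- r | P i) F i) 1.
Proof.
move=> F1; apply: (big_ind (fun p => eq_trunc R N p 1)) => // p q.
by rewrite -[X in _ -> _ -> eq_trunc _ _ _ X]mulr1; apply: eq_truncM.
Qed.

Lemma eq_trunc_1subXn (c : R) (m : nat) :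
  (N <= m)%N -> eq_trunc R N (1 - c *: 'X^m) 1.
Proof.
move=> Nm i iN; rewrite coefB coefZ coefXn ltn_eqF ?mulr0 ?subr0 //.
exact: leq_trans iN Nm.
Qed.

End Truncation.

(** * Truncated Euler products and their inverses *)

Section Products.
Variables (R : comNzRingType) (n : nat).

(** For [k = 1] this is the product of the 1 + y_i q^i; for [k = n] it agrees up to q^n with the
    product of the 1/(1 - y_i q^i). *)
Definition mult_gf (k : nat) (y : nat -> R) : {poly R} :=
  \prod_(i < n) \sum_(j < k.+1) (y i.+1 *: 'X^(i.+1)) ^+ j.

(** Expanding the product picks an exponent [j] in each factor, that is, a multiplicity for each
    part. *)
Lemma mult_gfE (k : nat) (y : nat -> R) :
  mult_gf k y =
  \sum_(p <- bounded_partitions n k) (\prod_(a <- p) y a) *: 'X^(sumn p).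
Proof.
rewrite /mult_gf bigA_distr_bigA big_map big_enum; apply: eq_bigr => f _.
rewrite big_partition_of_mult sumn_partition_of_mult.
rewrite -prodrXr -scaler_prod; apply: eq_bigr => i _.
by rewrite iter_mulr_1 exprZn -exprM mulnC.
Qed.

Definition euler_prod (y : nat -> R) : {poly R} :=
  \prod_(i < n) (1 - y i.+1 *: 'X^(i.+1)).

Lemma mult_gf1 (y : nat -> R) : mult_gf 1 y = euler_prod (fun a => - y a).
Proof.
apply: eq_bigr => i _.
by rewrite !big_ord_recl big_ord0 addr0 expr0 expr1 scaleNr opprK.
Qed.

(** Each pair of factors telescopes to 1 - (y_i q^i)^(n+1), and i(n+1) > n for i >= 1. *)
Lemma mult_gf_euler_prod (y : nat -> R) :
  eq_trunc R n.+1 (mult_gf n y * euler_prod y) 1.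
Proof.
rewrite -big_split; apply: eq_trunc_prod1 => i _ /=; rewrite mulrC -opprB mulNr -subrX1 opprB.
rewrite exprZn -exprM; apply: eq_trunc_1subXn.
by rewrite mulSn leq_addr.
Qed.

Lemma prod_1subX3 (m : nat) :
  \prod_(0 <= i < m) (1 - 'X^(3 * i.+1)) =
  \prod_(0 <= i < 3 * m | (3 %| i.+1)%N) (1 - 'X^(i.+1)) :> {poly R}.
Proof.
elim: m => [|m IH]; first by rewrite muln0 !big_nil.
rewrite big_nat_recr //= IH [in RHS]mulnS.
(* Of the three new indices on the right, only 3m+2 passes the filter, and it contributes 1 -
   q^(3m+3). *)
rewrite [RHS]big_mkcond !addSn add0n !big_nat_recr //= -[in RHS]big_mkcond /=.
have d3 k : (3 %| 3 * m + k)%N = (3 %| k)%N by rewrite dvdn_addr ?dvdn_mulr.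
rewrite -[(3 * m).+3]addn3 -[(3 * m).+2]addn2 -[(3 * m).+1]addn1 !d3 /= !mulr1.
by rewrite mulnS addnC.
Qed.

(** The left product is the right one continued up to index [3 * n]; the additional factors have
    exponents above [n]. *)
Lemma eq_trunc_prod_1subX3 :
  eq_trunc R n.+1 (\prod_(i < n) (1 - 'X^(3 * i.+1)))
    (\prod_(i < n | (3 %| i.+1)%N) (1 - 'X^(i.+1))).
Proof.
rewrite -(big_mkord xpredT (fun i => 1 - 'X^(3 * i.+1))).
rewrite prod_1subX3 (big_cat_nat (n := n)) //=; last by rewrite leq_pmull.
rewrite -(big_mkord (fun i => (3 %| i.+1)%N) (fun i => 1 - 'X^(i.+1))).
rewrite -[X in eq_trunc _ _ _ X]mulr1; apply: eq_truncM => //.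
rewrite big_nat_cond; apply: eq_trunc_prod1 => i /andP[/andP[ni _] _].
by rewrite -['X^_]scale1r; apply: eq_trunc_1subXn.
Qed.

End Products.

(** * Identities at a cube root of unity *)

Definition dirichlet_char3 (m : nat) : int :=
  (m %% 3 == 1)%N%:R - (m %% 3 == 2)%N%:R.

Section CubeRoot.
Variables (R : comNzRingType) (n : nat) (w : R).
Hypothesis w_root : 1 + w + w ^+ 2 = 0.

Let nthree (a : nat) : R := (~~ (3 %| a)%N)%:R.

(** Multiplied by [B], the truncation of (q;q), both sides become (q^3;q^3): the left one by
    cancelling the factors of index prime to 3, the right one factor by factor. Then [B] is
    cancelled. *)
Lemma euler_prod_cube_roots :
  eq_trunc R n.+1 (mult_gf R n n nthree)
    (euler_prod R n (fun=> w) * euler_prod R n (fun=> w ^+ 2)).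
Proof.
set C := mult_gf _ _ _ _; set B1 := euler_prod _ _ _; set B2 := euler_prod _ _ _.
pose A := mult_gf R n n (fun=> 1); pose B := euler_prod R n (fun=> 1).
have AB : eq_trunc R n.+1 (A * B) 1 by apply: mult_gf_euler_prod.
have B3 : B1 * B2 * B = \prod_(i < n) (1 - 'X^(3 * i.+1)).
  rewrite -!big_split; apply: eq_bigr => i _ /=.
  rewrite mulnC exprM -!mul_polyC polyC1 rmorphXn /=.
  have : 1 + w%:P + w%:P ^+ 2 = 0 :> {poly R}.
    by rewrite -polyC1 -rmorphXn -!rmorphD w_root.
  move: (w%:P) ('X^(i.+1)) => u x u0.
  (* The deviation from 1 - x^3 is written as an explicit multiple of 1 + u + u^2, so [ring] needs
     no relation on [u]. *)
  have -> : (1 - u * x) * (1 - u ^+ 2 * x) * (1 - 1 * x) =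
      (1 - x ^+ 3) + (1 + u + u ^+ 2) *
        (u * x ^+ 2 - x - (u - 1) * x ^+ 3).
    ring.
  by rewrite u0 mul0r addr0.
have CB : eq_trunc R n.+1 (C * B) (\prod_(i < n | (3 %| i.+1)%N) (1 - 'X^(i.+1))).
  have -> : B = euler_prod R n nthree *
      \prod_(i < n | (3 %| i.+1)%N) (1 - 'X^(i.+1)).
    rewrite [X in _ * X]big_mkcond -big_split; apply: eq_bigr => i _ /=.
    by rewrite /nthree; case: ifP; rewrite ?scale0r ?scale1r ?subr0 ?mul1r ?mulr1.
  rewrite mulrA -[X in eq_trunc _ _ _ X]mul1r; apply: eq_truncM => //.
  exact: mult_gf_euler_prod.
(* [A] serves as the inverse of [B] modulo q^(n+1). *)
have cancel p : eq_trunc R n.+1 (p * B * A) p.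
  rewrite -mulrA [B * A]mulrC -[X in eq_trunc _ _ _ X]mulr1.
  exact: eq_truncM.
apply: (eq_trunc_trans _ _ (C * B * A)); first exact/eq_trunc_sym/cancel.
apply: (eq_trunc_trans _ _ (B1 * B2 * B * A)); last exact/cancel.
apply: eq_truncM => //; apply: (eq_trunc_trans _ _ _ _ _ CB).
by rewrite B3; apply/eq_trunc_sym/eq_trunc_prod_1subX3.
Qed.

(** By [euler_prod_cube_roots] the first factor may be replaced by [B1 * B2]; each [A] is inverse to
    its [B], which leaves [B2 - B1]. *)
Lemma cube_root_identity :
  eq_trunc R n.+1
    (mult_gf R n n nthree *
       (mult_gf R n n (fun=> w) - mult_gf R n n (fun=> w ^+ 2)))
    (mult_gf R n 1 (fun=> - w ^+ 2) - mult_gf R n 1 (fun=> - w)).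
Proof.
set C := mult_gf R n n nthree.
rewrite !mult_gf1 (_ : (fun=> - - w ^+ 2) = fun=> w ^+ 2); last first.
  by apply/funext => ?; rewrite opprK.
rewrite (_ : (fun=> - - w) = fun=> w); last by apply/funext => ?; rewrite opprK.
set A1 := mult_gf _ _ _ _; set A2 := mult_gf _ _ _ _.
set B2 := euler_prod _ _ _; set B1 := euler_prod _ _ _.
apply: (eq_trunc_trans _ _ (B1 * B2 * (A1 - A2))).
  by apply: eq_truncM => //; apply: euler_prod_cube_roots.
have -> : B1 * B2 * (A1 - A2) = A1 * B1 * B2 - A2 * B2 * B1 by ring.
rewrite -[X in eq_trunc _ _ _ (X - _)]mul1r -[X in eq_trunc _ _ _ (_ - X)]mul1r.
by apply: eq_truncB; apply: eq_truncM => //; apply: mult_gf_euler_prod.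
Qed.

(** Both sides have period 3 in [m] because w^3 = 1; residue 2 gives w^2 - w^4 = -(w - w^2). *)
Lemma cube_root_expB (m : nat) :
  w ^+ m - (w ^+ 2) ^+ m = (dirichlet_char3 m)%:~R * (w - w ^+ 2).
Proof.
have w3 : w ^+ 3 = 1.
  have -> : w ^+ 3 = 1 + (w - 1) * (1 + w + w ^+ 2) by ring.
  by rewrite w_root mulr0 addr0.
rewrite /dirichlet_char3 -exprM -(expr_mod m w3) -(expr_mod (2 * m) w3) -modnMmr.
have := ltn_pmod m (isT : (0 < 3)%N).
case: (m %% 3)%N => [|[|[|]]] //= _; rewrite ?expr0 ?subrr ?mul0r //.
  by rewrite subr0 mul1r.
by rewrite sub0r mulN1r opprB.
Qed.

End CubeRoot.

(** * Comparison of coefficients with the two partition series *)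

Lemma coef_mult_gf (R : comNzRingType) (n k m : nat) (y : nat -> R) :
  (mult_gf R n k y)`_m =
  \sum_(p <- bounded_partitions n k | sumn p == m) \prod_(a <- p) y a.
Proof.
rewrite mult_gfE coef_sum [RHS]big_mkcond; apply: eq_bigr => p _.
by rewrite coefZ coefXn eq_sym; case: eqP; rewrite ?mulr1 ?mulr0.
Qed.

Lemma coef_mult_gfM (R : comNzRingType) (n k k' m : nat) (y z : nat -> R) :
  (mult_gf R n k y * mult_gf R n k' z)`_m =
  \sum_(pq <- [seq (p, q) | p <- bounded_partitions n k,
                            q <- bounded_partitions n k']
        | (sumn pq.1 + sumn pq.2)%N == m)
     (\prod_(a <- pq.1) y a) * \prod_(a <- pq.2) z a.
Proof.
rewrite !mult_gfE big_distrl /= coef_sum [RHS]big_mkcond big_allpairs /=.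
apply: eq_bigr => p _; rewrite big_distrr coef_sum /=; apply: eq_bigr => q _.
rewrite -scalerAl -scalerAr scalerA -exprD coefZ coefXn eq_sym.
by case: eqP; rewrite ?mulr1 ?mulr0.
Qed.

Lemma prod_const_seq (R : comNzRingType) (p : seq nat) (y : R) :
  \prod_(a <- p) y = y ^+ size p.
Proof. by rewrite big_const_seq count_predT iter_mulr_1. Qed.

Lemma prod_nthree (R : comNzRingType) (p : seq nat) :
  \prod_(a <- p) (~~ (3 %| a)%N)%:R = (all (fun a => ~~ (3 %| a)%N) p)%:R :> R.
Proof.
elim: p => [|a p IH]; first by rewrite big_nil.
by rewrite big_cons IH /=; case: (3 %| a)%N; rewrite ?mul0r ?mul1r.
Qed.

Lemma bounded_partitionsP (n k : nat) (p : seq nat) :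
  p \in bounded_partitions n k -> partitions p.
Proof. by case/mapP => f _ ->; apply: partition_of_multP. Qed.

Lemma uniq_bounded_partitions1 (n : nat) (p : seq nat) :
  p \in bounded_partitions n 1 -> uniq p.
Proof.
case/mapP => f _ ->; apply: count_mem_uniq => a.
set q := partition_of_mult _ _ _.
suff : (count_mem a q <= 1)%N.
  by rewrite -has_pred1 has_count; case: (count_mem a q) => [|[|]].
have [[i <-]|nai] := pselect (exists i : 'I_n, i.+1 = a).
  by rewrite count_partition_of_multS -ltnS.
rewrite count_partition_of_mult big1 // => i _.
by case: eqP => // ia; case: nai; exists i.
Qed.

Lemma mem_bounded_partitions_sumn (n : nat) (p : seq nat) :
  partitions p -> (sumn p <= n)%N -> p \in bounded_partitions n n.
Proof.
move=> Pp pn; apply: mem_bounded_partitions => // a.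
apply: leq_trans (count_size _ _) (leq_trans _ pn).
case: Pp => _; elim: p {pn} => //= b p IH /andP[b0 /IH].
by rewrite -add1n; apply: leq_add.
Qed.

(** Extending the sign by zero absorbs the size condition of [P3] into the character. *)
Lemma sign_sigma (p : seq nat) :
  (if (size p %% 3)%N != 0%N then (-1) ^+ sigma p else 0) = dirichlet_char3 (size p).
Proof.
rewrite /sigma /dirichlet_char3 (modn_small (isT : 2 < 3)%N).
by case: (size p %% 3)%N (ltn_pmod (size p) (isT : 0 < 3)%N) => [|[|[|]]].
Qed.

Lemma sign_mu (p : seq nat) :
  (if (size p %% 3)%N != 0%N then (-1) ^+ mu p else 0) =
  (-1) ^+ (size p).+1 * dirichlet_char3 (size p).
Proof.
rewrite -sign_sigma; case: ifP; rewrite ?mulr0 // => _.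
by rewrite -exprD /mu addn1 addSn.
Qed.

(** A distinct partition with m parts contributes (-w^2)^m - (-w)^m = (-1)^(m+1) (w^m - w^(2m)),
    which is w - w^2 times its sign extended by zero; the reversed order of the difference yields
    the summand 1 in [mu]. *)
Lemma coef_gen_series_P1 (w : algC) (n : nat) :
  1 + w + w ^+ 2 = 0 ->
  (gen_series P1 sumn (fun p => (-1) ^+ mu p) n)%:~R * (w - w ^+ 2) =
  (mult_gf algC n 1 (fun=> - w ^+ 2) - mult_gf algC n 1 (fun=> - w))`_n.
Proof.
move=> w_root; rewrite coefB !coef_mult_gf -sumrB /gen_series.
rewrite (@sum_set_seq _ _ _ (bounded_partitions n 1)); first last.
- move=> p [[[Pp up] _] /= sp]; apply: mem_bounded_partitions => //.
    by rewrite sp.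
  by move=> a; rewrite count_uniq_mem // leq_b1.
- exact: uniq_bounded_partitions.
rewrite rmorph_sum big_distrl /= big_mkcond [RHS]big_mkcond /=.
apply: eq_big_seq => p pr; rewrite !prod_const_seq.
have -> : (p \in P1 `&` [set p | sumn p = n]) =
          ((size p %% 3)%N != 0%N) && (sumn p == n).
  apply/idP/idP => [/set_mem[[_ /eqP sp] /eqP ->]|/andP[/eqP sp /eqP sn]].
    by rewrite andbT.
  apply/mem_set; split => //; split => //; split.
    exact: bounded_partitionsP pr.
  exact: uniq_bounded_partitions1 pr.
rewrite andbC; case: eqP => //= _.
rewrite (exprNn (w ^+ 2)) (exprNn w) -mulrBr -[X in _ = _ * X]opprB cube_root_expB //.
transitivity
  ((if (size p %% 3)%N != 0%N then (-1) ^+ mu p else 0)%:~R * (w - w ^+ 2)).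
  by case: ifP; rewrite ?mul0r.
by rewrite sign_mu rmorphM rmorphXn /= exprS rmorphN1; ring.
Qed.

(** The 0-1 weight on the first partition selects [P2]; the difference of powers of [w] for the
    second is w - w^2 times its sign, and vanishes outside [P3]. *)
Lemma coef_gen_series_P2_P3 (w : algC) (n : nat) :
  1 + w + w ^+ 2 = 0 ->
  (gen_series (P2 `*` P3) (fun pp => sumn pp.1 + sumn pp.2)%N
     (fun pp => (-1) ^+ sigma pp.2) n)%:~R * (w - w ^+ 2) =
  (mult_gf algC n n (fun a => (~~ (3 %| a)%N)%:R) *
     (mult_gf algC n n (fun=> w) - mult_gf algC n n (fun=> w ^+ 2)))`_n.
Proof.
move=> w_root; rewrite [in RHS]mulrBr coefB !coef_mult_gfM -sumrB /gen_series.
pose r := bounded_partitions n n.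
rewrite (@sum_set_seq _ _ _ [seq (p, q) | p <- r, q <- r]); first last.
- move=> [p q] [[[Pp _] [Pq _]] /= spq]; apply/allpairsP; exists (p, q).
  split=> //; apply: mem_bounded_partitions_sumn => //=; rewrite -spq.
    exact: leq_addr.
  exact: leq_addl.
- by apply: allpairs_uniq; [exact: uniq_bounded_partitions|
    exact: uniq_bounded_partitions|case=> ? ? []].
rewrite rmorph_sum big_distrl /= big_mkcond [RHS]big_mkcond /=.
apply: eq_big_seq => pq /allpairsP[[p q] [/= pr qr ->]] /=.
rewrite prod_nthree !prod_const_seq -mulrBr cube_root_expB //.
have -> : ((p, q) \in (P2 `*` P3) `&` [set pp | (sumn pp.1 + sumn pp.2)%N = n]) =
    [&& (sumn p + sumn q == n)%N, all (fun a => ~~ (3 %| a)%N) p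
      & (size q %% 3)%N != 0%N].
  apply/idP/idP => [/set_mem[[[_ /= p3] [_ /= /eqP q3]] /= /eqP ->]|].
    by rewrite q3 andbT; apply/allP.
  case/and3P => /eqP spq /allP p3 /eqP q3.
  by apply/mem_set; split => //; split; split => //;
    [apply: bounded_partitionsP pr|apply: bounded_partitionsP qr].
case: eqP => //= _; case: all; rewrite ?mul0r //= mul1r -sign_sigma.
by case: ifP; rewrite ?mul0r.
Qed.

Theorem theorem32 :
  gen_series P1 sumn (fun p => (-1) ^+ mu p) =
  gen_series (P2 `*` P3) (fun pp => sumn pp.1 + sumn pp.2)%N
    (fun pp => (-1) ^+ sigma pp.2).
Proof.
have [w w_prim] := C_prim_root_exists (isT : (0 < 3)%N).
have w1 : w - 1 != 0.
  by rewrite subr_eq0 -[w]expr1 -(prim_order_dvd w_prim).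
have w0 : w != 0.
  apply: contra_eq_neq (prim_expr_order w_prim) => ->.
  by rewrite expr0n eq_sym oner_eq0.
have w_root : 1 + w + w ^+ 2 = 0.
  apply: (mulfI w1); rewrite mulr0.
  have -> : (w - 1) * (1 + w + w ^+ 2) = w ^+ 3 - 1 by ring.
  by rewrite prim_expr_order // subrr.
have ww : w - w ^+ 2 != 0.
  have -> : w - w ^+ 2 = - (w * (w - 1)) by ring.
  by rewrite oppr_eq0 mulf_neq0.
(* Integers embed in [algC], so the identity may be checked there after multiplication by the
   nonzero w - w^2. *)
apply/funext => n; apply: (@intr_inj algC); apply: (mulIf ww).
rewrite coef_gen_series_P1 // coef_gen_series_P2_P3 //.
by rewrite (cube_root_identity algC n w).
Qed.
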